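(* Let $n\ge1$ and let $c_{pq}$ ($1\le p<q\le n$) be real numbers. Let $u_1,\dots,u_n$ be the standard basis of $\mathbb{R}^n$, and let $\sigma_{pq}:\mathbb{R}^n\to\mathbb{R}^n$ be the reflection exchanging the $p$-th and $q$-th coordinates: $\sigma_{pq}(u_p)=u_q$, $\sigma_{pq}(u_q)=u_p$, $\sigma_{pq}(u_i)=u_i$ for $i\neq p,q$. Then the characteristic polynomial of the operator $M=\sum_{1\le p<q\le n}c_{pq}(1-\sigma_{pq})$ on $\mathbb{R}^n$ is $\sum_{k=0}^n(-1)^k\mu_kt^{n-k}$, where $$\mu_k=\sum_{F\in\mathcal{F}_{n,k}}\ \prod_{(pq)\text{ an edge of }F}c_{pq}\ \prod_{i=1}^{n-k}(m_i+1).$$ Here $\mathcal{F}_{n,k}$ is the set of forests with vertices $1,\dots,n$, with $k$ edges and $n-k$ components, and $m_i$ is the number of edges in the $i$-th component of $F$.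
   Context: The characteristic polynomial of $M$ is $\det(t\cdot\mathrm{id}-M)$; $1$ denotes the identity operator. Forests are acyclic simple undirected graphs on the labelled vertex set $\{1,\dots,n\}$; isolated vertices count as components with $0$ edges. *)

(* Defs.v *)
From HB Require Import structures.
From mathcomp Require Export all_boot all_order all_fingroup all_algebra.
From mathcomp Require Export boolp reals.

Set Implicit Arguments.
Unset Strict Implicit.
Unset Printing Implicit Defensive.

Import GRing.Theory.
Local Open Scope ring_scope.

(** R^n is ['rV[R]_n], with standard basis [delta_mx 0 i]. *)

Definition reflection (R : realType) (n : nat) (p q : 'I_n) (u : 'rV[R]_n)
    : 'rV[R]_n :=
  xcol p q u.

Lemma reflection_basis (R : realType) (n : nat) (p q i : 'I_n) :
  reflection p q (delta_mx 0 i) = delta_mx 0 (tperm p q i) :> 'rV[R]_n.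
Proof.
apply/rowP => j; rewrite /reflection !mxE !eqxx /=.
by rewrite (canF_eq (tpermK p q)).
Qed.

(** M = sum_(p < q) c_pq (1 - sigma_pq). Only the values [c p q] with [p < q]
    are used, here and below. *)
Definition reflection_operator (R : realType) (n : nat)
    (c : 'I_n -> 'I_n -> R) (u : 'rV[R]_n) : 'rV[R]_n :=
  \sum_(p < n) \sum_(q < n | (p < q)%N) c p q *: (u - reflection p q u).

Lemma reflection_operator_is_linear (R : realType) (n : nat)
    (c : 'I_n -> 'I_n -> R) :
  linear (reflection_operator c).
Proof.
move=> a u v; rewrite /reflection_operator scaler_sumr -big_split /=.
apply: eq_bigr => p _; rewrite scaler_sumr -big_split /=.
apply: eq_bigr => q _; rewrite /reflection /xcol linearP /=.
rewrite scalerA mulrC -scalerA -scalerDr; congr (_ *: _).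
by rewrite scalerBr opprD addrACA.
Qed.

HB.instance Definition _ (R : realType) (n : nat) (c : 'I_n -> 'I_n -> R) :=
  GRing.isLinear.Build R 'rV[R]_n 'rV[R]_n *:%R (reflection_operator c)
    (reflection_operator_is_linear c).

(** A simple undirected graph on the vertices ['I_n] is given by its edge set,
    the edge joining p and q being recorded once, as the pair with p < q. *)
Definition simple_graph (n : nat) (E : {set 'I_n * 'I_n}) : bool :=
  [forall e in E, (e.1 < e.2)%N].

Definition adjacent (n : nat) (E : {set 'I_n * 'I_n}) : rel 'I_n :=
  fun p q => ((p, q) \in E) || ((q, p) \in E).

(** The length bound is needed because [:: p; q] with p and q adjacent is a
    closed [ucycle] that traverses a single edge back and forth. *)
Definition acyclic (n : nat) (E : {set 'I_n * 'I_n}) : Prop :=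
  forall s : seq 'I_n, (3 <= size s)%N -> ~ ucycle (adjacent E) s.

(** Vertex sets of the connected components. *)
Definition components (n : nat) (E : {set 'I_n * 'I_n}) : {set {set 'I_n}} :=
  equivalence_partition (connect (adjacent E)) [set: 'I_n].

Definition component_edges (n : nat) (E : {set 'I_n * 'I_n}) (B : {set 'I_n})
    : {set 'I_n * 'I_n} :=
  [set e in E | (e.1 \in B) && (e.2 \in B)].

Definition forests (n k : nat) : {set {set 'I_n * 'I_n}} :=
  [set F | [&& simple_graph F, `[< acyclic F >], #|F| == k
             & #|components F| == (n - k)%N]].

Definition mu (R : realType) (n : nat) (c : 'I_n -> 'I_n -> R) (k : nat) : R :=
  \sum_(F in forests n k)
    (\prod_(e in F) c e.1 e.2) *
    (\prod_(B in components F) (#|component_edges F B| + 1)%:R).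

(* Main.v *)
Require Import Defs.
From mathcomp Require Import zify ring.

(** The operator M is [V^T D V], where V is the matrix whose rows are the
    vectors [v_e = u_p - u_q] of all pairs [e = (p, q)] and D is the diagonal
    matrix of the coefficients (0 unless p < q), because [1 - sigma_pq] is the
    rank-one map [u |-> <u, v_e> v_e] ([sub_reflection]). Up to powers of t,
    [V^T D V] has the same characteristic polynomial as [D (V V^T)], and the
    multilinearity of the determinant in its rows expands the latter as a sum
    over edge sets F: the term of F is, up to sign, the product of the
    coefficients over F times the Gram determinant of the vectors
    [v_e], [e \in F] ([char_poly_weighted_gram]).

    It remains to compute the Gram determinant g(F). A new vector multiplies a
    Gram determinant by the squared distance of that vector from the span of
    the previous ones ([gram_mx_setU1]). The span of the [v_e], [e \in F], has
    as orthogonal complement the vectors constant on the components of F, so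
    the projection of [u_p - u_q] on this complement is the difference of the
    averages over the components P of p and Q of q. Hence a new edge pq
    multiplies g by 0 if [P = Q], and otherwise by [1/|P| + 1/|Q|], which is
    [(|P| + |Q|) / (|P| |Q|)], the size of the merged component over the product
    of the former sizes
    ([edge_gram_setU1]).

    If F has a cycle, some edge of F joins two vertices that the other edges
    already connect ([cyclic_redundant_edge]), so [g(F) = 0]. If F is a forest,
    adding its edges one at a time always merges two components
    ([forest_ind]); thus g(F) is the product of the component sizes, and a
    component with m edges has m + 1 vertices ([forest_counts]). *)

Set Implicit Arguments.
Unset Strict Implicit.
Unset Printing Implicit Defensive.
Import GRing.Theory Num.Theory.
Local Open Scope ring_scope.

(** * Determinants *)

(** Both sides are the determinant of the block matrix K of the proof, made
    triangular by two different column operations. *)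
Lemma det_scalar_sub_mulC (R : comNzRingType) (m n : nat) (x : R)
    (A : 'M[R]_(n, m)) (B : 'M[R]_(m, n)) :
  \det (x%:M - A *m B) * x ^+ m = x ^+ n * \det (x%:M - B *m A).
Proof.
pose K := block_mx x%:M A B 1%:M : 'M_(n + m).
have <- : \det K = \det (x%:M - A *m B).
  have -> : \det K = \det (K *m block_mx 1%:M 0 (- B) 1%:M).
    by rewrite det_mulmx det_lblock !det1 !mulr1.
  by rewrite mulmx_block !mulmx1 !mulmx0 !mulmxN mul1mx subrr add0r
     add0r det_ublock det1 mulr1.
have <- : \det (K *m block_mx 1%:M (- A) 0 x%:M)
          = x ^+ n * \det (x%:M - B *m A).
  rewrite mulmx_block !mulmx1 !mulmx0 !addr0 !mulmxN mul1mx.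
  by rewrite scalar_mxC addNr det_lblock det_scalar addrC.
by rewrite det_mulmx det_ublock det1 mul1r det_scalar.
Qed.

Lemma det_addmx_rows (R : comNzRingType) (m : nat) (A B : 'M[R]_m) :
  \det (A + B) =
    \sum_(J : {set 'I_m})
       \det (\matrix_(i, j) if i \in J then A i j else B i j).
Proof.
rewrite /determinant exchange_big; apply: eq_bigr => s _ /=.
rewrite -mulr_sumr; congr (_ * _).
rewrite (eq_bigr (fun i => A i (s i) + B i (s i))) => [|i _]; last first.
  by rewrite mxE.
rewrite bigA_distr; apply: eq_bigr => J _.
by apply: eq_bigr => i _; rewrite mxE.
Qed.

(** The rows outside J are those of the identity, so the determinant is the
    Gram determinant of the rows of V indexed by J, while all J share the same
    matrix size. *)
Definition gram_mx (R : nzRingType) (m n : nat) (V : 'M[R]_(m, n))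
    (J : {set 'I_m}) : 'M[R]_m :=
  \matrix_(i, j) if i \in J then (V *m V^T) i j else (i == j)%:R.

(** After the exchange of factors, row i of the matrix is the sum of
    [-d_i <v_i, _>] and of ['X] times a basis vector. Choosing the first summand
    exactly for the rows in J gives the Gram matrix of J with rows scaled by
    the entries of [k]. *)
Lemma char_poly_weighted_gram (R : comNzRingType) (m n : nat)
    (V : 'M[R]_(m, n)) (d : 'rV[R]_m) :
  char_poly (V^T *m diag_mx d *m V) * 'X^m =
  'X^n * \sum_(J : {set 'I_m})
     ((-1) ^+ #|J| * ((\prod_(i in J) d 0 i) * \det (gram_mx V J)))
       *: 'X^(m - #|J|).
Proof.
pose Vp := map_mx polyC V; pose dp := diag_mx (map_mx polyC d).
have -> : char_poly (V^T *m diag_mx d *m V)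
        = \det ('X%:M - Vp^T *m (dp *m Vp)).
  by rewrite /char_poly /char_poly_mx !map_mxM map_trmx map_diag_mx mulmxA.
rewrite det_scalar_sub_mulC; congr (_ * _).
rewrite addrC det_addmx_rows; apply: eq_bigr => J _.
pose k := \row_i (if i \in J then - (d 0 i)%:P else 'X : {poly R}).
have -> : (\matrix_(i, j) if i \in J then (- (dp *m Vp *m Vp^T)) i j
             else ('X%:M : 'M[{poly R}]_m) i j)
          = diag_mx k *m map_mx polyC (gram_mx V J) :> 'M_m.
  apply/matrixP => i j; rewrite -mulmxA map_trmx -map_mxM mxE.
  rewrite (mul_diag_mx k) [in RHS]mxE.
  have -> : map_mx polyC (gram_mx V J) i j
            = (if i \in J then (V *m V^T) i j else (i == j)%:R)%:P.
    by rewrite mxE /gram_mx mxE.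
  rewrite [k _ _]mxE.
  case: ifP => iJ; last by rewrite mxE polyC_natr mulr_natr.
  by rewrite mxE mul_diag_mx !mxE mulNr.
rewrite det_mulmx det_diag det_map_mx.
rewrite (bigID [in J]) /= (eq_bigr (fun i => (- 1) * (d 0 i)%:P)); last first.
  by move=> i iJ; rewrite mxE iJ mulN1r.
rewrite big_split /= prodr_const.
rewrite [X in _ * X * _](eq_bigr (fun=> 'X)); last first.
  by move=> i /negPf iJ; rewrite mxE iJ.
rewrite prodr_const -rmorph_prod /= -mul_polyC !rmorphM /= rmorphXn rmorphN1 /=.
have -> : #|[pred i | i \notin J]| = (m - #|J|)%N.
  apply/eqP; rewrite -(eqn_add2l #|J|) cardC card_ord subnKC //.
  by rewrite -[leqRHS]card_ord max_card.
by rewrite -!mulrA; congr (_ * (_ * _)); rewrite mulrC.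
Qed.

(** Here w is the component of [row e V] orthogonal to the rows in J, and the
    factor [<w, row e V>] is its squared length: modulo the rows in J, the new
    row of the Gram matrix is the pairing with w, which vanishes on J. *)
Lemma gram_mx_setU1 (R : fieldType) (m n : nat) (V : 'M[R]_(m, n))
    (J : {set 'I_m}) (e : 'I_m) (w : 'rV[R]_n) :
  e \notin J ->
  (row e V - w <= \matrix_i (if i \in J then row i V else 0))%MS ->
  (forall i, i \in J -> w *m (row i V)^T = 0) ->
  \det (gram_mx V (e |: J)) = (w *m (row e V)^T) 0 0 * \det (gram_mx V J).
Proof.
move=> eJ /submxP[D defD] w_orth.
(* The coefficients of row e of the new matrix on the rows of the old one: a
   row outside J is a basis vector, so its coefficient is the entry itself. *)
pose a : 'rV_m := \row_i if i \in J then D 0 i else (w *m (row i V)^T) 0 0.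
have row_e : row e (gram_mx V (e |: J)) = a *m gram_mx V J.
  apply/rowP => j; rewrite !mxE setU11.
  have -> : \sum_k V e k * V^T k j = ((row e V - w) *m (row j V)^T) 0 0
            + (w *m (row j V)^T) 0 0.
    rewrite mulmxBl [X in X + _]mxE [X in _ + X + _]mxE subrK mxE.
    by apply: eq_bigr => k _; rewrite !mxE.
  rewrite defD -mulmxA [X in X + _]mxE (bigID [in J]) [RHS](bigID [in J]) /=.
  rewrite -addrA; congr (_ + _).
    apply: eq_bigr => i iJ; rewrite !mxE iJ; congr (_ * _).
    by apply: eq_bigr => k _; rewrite !mxE iJ !mxE.
  rewrite big1 => [|i iJ]; last first.
    by rewrite mxE big1 ?mulr0 // => k _; rewrite mxE (negPf iJ) mxE mul0r.
  rewrite add0r; have [jJ|jJ] := boolP (j \in J).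
    rewrite w_orth // mxE big1 // => i iJ; rewrite !mxE (negPf iJ).
    by rewrite (negPf (memPnC iJ _ jJ)) ?mulr0.
  rewrite (bigD1 j) //= big1 => [|i /andP[iJ ij]]; last first.
    by rewrite !mxE (negPf iJ) (negPf ij) mulr0.
  by rewrite !mxE (negPf jJ) eqxx mulr1 addr0.
(* The two matrices differ only in row e, hence have the same cofactors there. *)
rewrite (expand_det_row _ e).
transitivity ((a *m gram_mx V J *m \adj (gram_mx V J)) 0 e).
  rewrite -row_e mxE; apply: eq_bigr => j _.
  rewrite [row _ _ _ _]mxE [\adj _ _ _]mxE; congr (_ * _).
  rewrite /cofactor; congr (_ * \det _); apply/matrixP => i i'.
  by rewrite !mxE in_setU1 eq_sym (negPf (neq_lift _ _)).
by rewrite -mulmxA mul_mx_adj mul_mx_scalar mxE mulrC mxE (negPf eJ).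
Qed.

(** * Components of a graph when an edge is added *)

Section Graphs.
Variable n : nat.
Implicit Types (F G : {set 'I_n * 'I_n}) (B : {set 'I_n}) (p q x y : 'I_n).

Definition component F x : {set 'I_n} := [set y | connect (adjacent F) x y].

Lemma adjacent_sym F : symmetric (adjacent F).
Proof. by move=> x y; rewrite /adjacent orbC. Qed.

Lemma connect_adjacent_sym F : connect_sym (adjacent F).
Proof. exact: sym_connect_sym (adjacent_sym F). Qed.

Lemma adjacent_setU1 F p q x y :
  adjacent ((p, q) |: F) x y =
    [|| adjacent F x y, (x == p) && (y == q) | (x == q) && (y == p)].
Proof.
by rewrite /adjacent !in_setU1 !xpair_eqE [(y == p) && _]andbC orbACA orbC.
Qed.

Lemma eq_component F x y :
  (component F x == component F y) = connect (adjacent F) x y.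
Proof.
apply/eqP/idP => [/setP/(_ y) | xy]; first by rewrite !inE connect0.
apply/setP => z; rewrite !inE.
exact: (same_connect (connect_adjacent_sym F) xy).
Qed.

Lemma component_id F x y : y \in component F x -> component F y = component F x.
Proof. by rewrite inE -eq_component => /eqP. Qed.

Lemma componentsE F : components F = [set component F x | x in [set: 'I_n]].
Proof.
by apply: eq_imset => x; apply/setP => y; rewrite !inE.
Qed.

Lemma mem_components F x : component F x \in components F.
Proof. by rewrite componentsE imset_f. Qed.

Lemma componentsP F B :
  reflect (exists x, B = component F x) (B \in components F).
Proof.
rewrite componentsE; apply: (iffP imsetP) => [[x _ ->]|[x ->]]; by exists x.
Qed.

Lemma connect_setU1 F p q x y :
  connect (adjacent ((p, q) |: F)) x y =
    [|| connect (adjacent F) x y,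
        connect (adjacent F) x p && connect (adjacent F) q y
      | connect (adjacent F) x q && connect (adjacent F) p y].
Proof.
apply/idP/idP => [/connectP[s]|].
  elim: s x => [|z s IHs] x /=; first by move=> _ ->; rewrite connect0.
  case/andP => + zs ys; move: {IHs zs ys}(IHs z zs ys).
  rewrite adjacent_setU1 => IHz.
  case/or3P=> [xz|/andP[/eqP-> /eqP zq]|/andP[/eqP-> /eqP zp]].
  - have xz' := connect1 xz; have sF := connect_adjacent_sym F.
    by rewrite !(same_connect sF xz').
  - rewrite connect0 /=; case/or3P: IHz => [|/andP[_]|/andP[_]].
    + by rewrite zq => ->; rewrite orbT.
    + by move=> ->; rewrite orbT.
    + by move=> ->.
  - rewrite connect0 /=; case/or3P: IHz => [|/andP[_]|/andP[_]].
    + by rewrite zp => ->; rewrite !orbT.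
    + by move=> ->.
    + by move=> ->; rewrite !orbT.
have sub : subrel (connect (adjacent F)) (connect (adjacent ((p, q) |: F))).
  by apply: connect_sub => u v uv; apply: connect1; rewrite adjacent_setU1 uv.
have pq : connect (adjacent ((p, q) |: F)) p q.
  by apply: connect1; rewrite adjacent_setU1 !eqxx orbT.
case/or3P => [/sub //|/andP[/sub xp /sub qy]|/andP[/sub xq /sub py]].
  exact: connect_trans xp (connect_trans pq qy).
rewrite connect_adjacent_sym in pq.
exact: connect_trans xq (connect_trans pq py).
Qed.

Lemma component_setU1 F p q x :
  component ((p, q) |: F) x =
    if x \in component F p :|: component F q
    then component F p :|: component F q else component F x.
Proof.
have sF := connect_adjacent_sym F.
apply/setP => y; rewrite inE connect_setU1 !inE.
rewrite [connect _ x p]sF [connect _ x q]sF.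
case: (boolP (connect _ p x)) => [px|_] /=.
  rewrite -(same_connect sF px) !inE.
  by case: (connect _ p y); case: (connect _ q y); rewrite ?andbF.
case: (boolP (connect _ q x)) => [qx|_] /=; last by rewrite orbF inE.
by rewrite -(same_connect sF qx) !inE orbC.
Qed.

Section AddEdge.
Variables (F : {set 'I_n * 'I_n}) (p q : 'I_n).
Hypothesis pq : ~~ connect (adjacent F) p q.
Let P := component F p.
Let Q := component F q.

Lemma component_neq : Q != P.
Proof. by rewrite eq_sym eq_component. Qed.

Lemma components_setU1 :
  components ((p, q) |: F) = (P :|: Q) |: (components F :\ P) :\ Q.
Proof.
apply/setP => B; rewrite !inE; apply/componentsP/idP => [[x ->]|].
  rewrite component_setU1; case: ifPn => [_|]; first by rewrite eqxx.
  rewrite in_setU negb_or => /andP[xP xQ]; rewrite mem_components andbT.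
  rewrite !eq_component ![connect _ x _]connect_adjacent_sym.
  by move: xP xQ; rewrite !inE => -> ->; rewrite orbT.
case/predU1P => [->|/and3P[BQ BP /componentsP[x defB]]].
  by exists p; rewrite component_setU1 !inE connect0.
exists x; rewrite component_setU1 defB in_setU.
case: ifP => // /orP[] xPQ; last by rewrite defB (component_id xPQ) eqxx in BQ.
by rewrite defB (component_id xPQ) eqxx in BP.
Qed.

(** The trade of P and Q for their union, written without division so that it
    serves both for counting components and for multiplying their sizes. *)
Lemma big_components_setU1 (T : Type) (idx : T) (op : Monoid.com_law idx)
    (f : {set 'I_n} -> T) :
  op (\big[op/idx]_(B in components ((p, q) |: F)) f B) (op (f P) (f Q)) =
  op (\big[op/idx]_(B in components F) f B) (f (P :|: Q)).
Proof.
have QP : Q \in components F :\ P by rewrite !inE component_neq mem_components.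
rewrite components_setU1 big_setU1 /=; last first.
  apply/negP; rewrite !inE => /and3P[_ + /componentsP[x defx]].
  have: p \in component F x by rewrite -defx !inE connect0.
  by rewrite defx /P => /component_id ->; rewrite eqxx.
rewrite [in RHS](big_setD1 P) ?mem_components //= [in RHS](big_setD1 Q) //=.
rewrite Monoid.mulmC [op (f (P :|: Q)) _]Monoid.mulmC.
by rewrite !Monoid.mulmA.
Qed.

Lemma card_component_setU : #|P :|: Q| = (#|P| + #|Q|)%N.
Proof.
rewrite cardsU (_ : P :&: Q = set0) ?cards0 ?subn0 //.
apply/setP => x; rewrite in_set0 in_setI; apply/negP => /andP[xP xQ].
by move: component_neq; rewrite /P -(component_id xP) (component_id xQ) eqxx.
Qed.

(** Both ends of an edge of F lie in the same component, so no edge of F joins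
    P and Q. *)
Lemma component_edges_setU1_merged :
  (p, q) \notin F ->
  #|component_edges ((p, q) |: F) (P :|: Q)| =
    (#|component_edges F P| + #|component_edges F Q|).+1.
Proof.
move=> pqF.
have split_edges : component_edges ((p, q) |: F) (P :|: Q) =
    (p, q) |: (component_edges F P :|: component_edges F Q).
  apply/setP => f; rewrite !inE; case: eqP => [->|_] /=.
    by rewrite !connect0 ?orbT.
  case fF: (f \in F) => //=; have sF := connect_adjacent_sym F.
  have f12 : connect (adjacent F) f.1 f.2.
    by apply: connect1; rewrite /adjacent -surjective_pairing fF.
  rewrite ![connect _ p _]sF ![connect _ q _]sF !(same_connect sF f12).
  by case: (connect _ _ _); case: (connect _ _ _).
rewrite split_edges cardsU1 !inE (negPf pqF) /= add1n cardsU.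
rewrite (_ : _ :&: _ = set0) ?cards0 ?subn0 //.
apply/setP => f; rewrite in_set0 in_setI !in_set; apply/negP.
case/andP => /and3P[_ fP _] /and3P[_ fQ _].
move: component_neq; rewrite /P /Q -(@component_id _ p f.1) ?inE //.
by rewrite -(@component_id _ q f.1) ?inE // eqxx.
Qed.

Lemma component_edges_setU1_other B :
  B \in components F -> B != P ->
  component_edges ((p, q) |: F) B = component_edges F B.
Proof.
case/componentsP=> x -> xP; apply/setP => f; rewrite !inE.
case: eqP => [->|//] /=.
case: (boolP (connect _ x p)) => [xp|]; last by rewrite andbF.
by rewrite -eq_component in xp; rewrite xp in xP.
Qed.

End AddEdge.

(** * Forests *)

Lemma acyclic_setU1 F p q :
  acyclic ((p, q) |: F) -> acyclic F.
Proof.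
move=> acF s s3 /andP[cs us]; apply: (acF s s3); apply/andP; split=> //.
by apply: sub_cycle cs => x y xy; rewrite adjacent_setU1 xy.
Qed.

(** A simple path from p to q in F would be closed into a cycle by the edge pq;
    its length is at least 3 because F does not contain pq. *)
Lemma acyclic_setU1_disconnected F p q :
  simple_graph ((p, q) |: F) -> (p, q) \notin F ->
  acyclic ((p, q) |: F) -> ~~ connect (adjacent F) p q.
Proof.
move=> /'forall_implyP simpleF pqF acF; apply/negP => /connectP[s ps qs].
have ltpq : (p < q)%N by apply: (simpleF (p, q)); rewrite setU11.
case/shortenP: ps qs => s' ps' us' _ qs'.
have s'3 : (3 <= size (p :: s'))%N.
  case: s' ps' qs' {us'} => [|x [|y s']] //= ps' qs'.
    by rewrite qs' ltnn in ltpq.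
  move: ps'; rewrite andbT -qs' /adjacent (negPf pqF) /= => qpF.
  have := simpleF (q, p); rewrite in_setU1 qpF orbT => /(_ isT) /=.
  by rewrite ltnNge (ltnW ltpq).
apply: (acF _ s'3); rewrite /ucycle /path.cycle rcons_path us' andbT -qs'.
rewrite adjacent_setU1 !eqxx !orbT andbT.
by apply: sub_path ps' => x y xy; rewrite adjacent_setU1 xy.
Qed.

(** The first edge of a cycle is redundant: the rest of the cycle connects its
    two ends, and does not use it again because the vertices are distinct. *)
Lemma cyclic_redundant_edge F :
  ~ acyclic F ->
  exists2 e, e \in F & connect (adjacent (F :\ e)) e.1 e.2.
Proof.
move=> /existsNP[s] /not_implyP[s3] /contrapT.
case: s s3 => [|x [|y [|z s]]] // _ /andP[/=/and3P[xy yz]].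
rewrite rcons_path => /andP[zs sx] /and3P[].
rewrite !inE !negb_or => /and3P[xy' xz xs] /andP[yz' ys] _.
have yx e : e = (x, y) \/ e = (y, x) -> connect (adjacent (F :\ e)) y x.
  move=> def_e.
  (* Pairs avoiding x or avoiding y are not affected by the removal of e. *)
  have keep a b : adjacent F a b ->
      (a != y) && (b != y) || (a != x) && (b != x) ->
      adjacent (F :\ e) a b.
    rewrite /adjacent !in_setD1.
    by case: def_e => ->; rewrite !xpair_eqE;
       case: (a == x); case: (a == y); case: (b == x); case: (b == y).
  have path_z : connect (adjacent (F :\ e)) z (last z s).
    apply/connectP; exists s => //.
    have noty : all (predC1 y) (z :: s).
      by apply/allP => a; rewrite inE => /predU1P[->|as_] /=;
        [rewrite eq_sym | apply: contraNneq ys => <-].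
    apply: sub_in_path noty zs => a b; rewrite !inE => ay byy ab.
    by apply: keep => //; rewrite ay byy.
  apply: connect_trans (connect_trans path_z _); apply: connect1;
    apply: keep => //.
    by rewrite ![_ == x]eq_sym xy' xz orbT.
  rewrite xy' andbT; apply/orP; left; have := mem_last z s.
  by rewrite inE => /predU1P[->|]; [rewrite eq_sym | apply: contraTneq => ->].
move: xy; rewrite /adjacent => /orP[xyF|yxF].
  exists (x, y) => //=; rewrite connect_adjacent_sym; apply: yx; by left.
by exists (y, x) => //=; apply: yx; right.
Qed.

Lemma simple_graph_setU1 F p q : simple_graph ((p, q) |: F) -> simple_graph F.
Proof.
move=> /'forall_implyP simpleF; apply/'forall_implyP => f fF.
by apply: simpleF; rewrite inE fF orbT.
Qed.

Lemma component0 x : component set0 x = [set x].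
Proof.
apply/setP => y; rewrite !inE; apply/connectP/eqP => [[[|z s] //=]|->].
  by rewrite /adjacent !inE.
by exists [::].
Qed.

(** Subsets of forests are forests, and each edge joins two components of the
    graph formed by the other edges. *)
Lemma forest_ind (Prp : {set 'I_n * 'I_n} -> Prop) :
  Prp set0 ->
  (forall F p q, (p, q) \notin F -> ~~ connect (adjacent F) p q ->
     Prp F -> Prp ((p, q) |: F)) ->
  forall F, simple_graph F -> acyclic F -> Prp F.
Proof.
move=> P0 PU F; move: {2}#|F| (erefl #|F|) => k; elim: k F => [|k IHk] F cardF.
  by move/cards0_eq: cardF => ->.
have [[p q] pqF] : exists e, e \in F by apply/set0Pn; rewrite -cards_eq0 cardF.
rewrite -(setD1K pqF) => simpleF acF.
have pqF' : (p, q) \notin F :\ (p, q) by rewrite setD11.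
apply: PU => //; first exact: acyclic_setU1_disconnected simpleF pqF' acF.
apply: IHk (simple_graph_setU1 simpleF) (acyclic_setU1 acF).
by move: cardF; rewrite (cardsD1 (p, q)) pqF => -[].
Qed.

(** Every edge of a forest merges two components, so it lowers their number by
    one and turns two trees into one tree with a single further edge. *)
Lemma forest_counts F :
  simple_graph F -> acyclic F ->
  (#|components F| + #|F|)%N = n /\
  forall B, B \in components F -> (#|component_edges F B| + 1)%N = #|B|.
Proof.
move: F; apply: forest_ind => [|F p q pqF pq [cardF edgesF]].
  split=> [|B /componentsP[x ->]].
    rewrite cards0 addn0 componentsE card_imset ?cardsT ?card_ord //.
    by move=> x y; rewrite !component0 => /set1_inj.
  rewrite component0 cards1 (_ : component_edges _ _ = set0) ?cards0 //.
  by apply/setP => f; rewrite !inE.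
split=> [|B].
  have := big_components_setU1 pq addn (fun=> 1%N).
  rewrite !sum1_card cardsU1 pqF -[X in _ -> _ = X]cardF /=.
  by rewrite addnA !addn1 add1n => -[<-]; rewrite addnS addSn.
rewrite components_setU1 // => /setU1P[->|]; rewrite ?inE.
  rewrite card_component_setU // component_edges_setU1_merged //.
  rewrite -!edgesF ?mem_components //; lia.
by case/and3P => BQ BP BF; rewrite component_edges_setU1_other ?edgesF.
Qed.

Lemma mem_forests k F :
  (F \in forests n k) =
    [&& simple_graph F, `[< acyclic F >] & #|F| == k].
Proof.
rewrite inE; case: (boolP (simple_graph F)) => //= simpleF.
case: asboolP => //= acF; case: eqP => //= <-.
have [cardF _] := forest_counts simpleF acF.
by apply/eqP; rewrite -[LHS](addnK #|F|) cardF.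
Qed.

End Graphs.

(** * Edge sets as sets of matrix rows *)

Section EdgeRanks.
Variable n : nat.
Implicit Type F : {set 'I_n * 'I_n}.

Definition edge_ranks F : {set 'I_#|{: 'I_n * 'I_n}|} :=
  [set i | enum_val i \in F].

Lemma edge_ranks_bij : bijective edge_ranks.
Proof.
exists (fun J : {set 'I_#|{: 'I_n * 'I_n}|} =>
  [set e : 'I_n * 'I_n | enum_rank e \in J]) => J; apply/setP => i.
  by rewrite !inE enum_rankK.
by rewrite !inE enum_valK.
Qed.

Lemma edge_ranks_setU1 F e : edge_ranks (e |: F) = enum_rank e |: edge_ranks F.
Proof.
apply/setP => i; rewrite !inE; congr (_ || _).
by rewrite -(inj_eq enum_val_inj) enum_rankK.
Qed.

Lemma big_edge_ranks (T : Type) (idx : T) (op : Monoid.com_law idx)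
    (f : 'I_n * 'I_n -> T) F :
  \big[op/idx]_(i in edge_ranks F) f (enum_val i) = \big[op/idx]_(e in F) f e.
Proof.
rewrite [RHS](reindex _ (onW_bij _ (@enum_val_bij ('I_n * 'I_n)%type))) /=.
by apply: eq_bigl => i; rewrite inE.
Qed.

Lemma card_edge_ranks F : #|edge_ranks F| = #|F|.
Proof. by rewrite -!sum1_card; apply: (big_edge_ranks _ (fun=> 1%N)). Qed.

End EdgeRanks.

(** * Gram determinants of edge vectors *)

Section EdgeVectors.
Variables (R : realType) (n : nat).
Implicit Types (F G : {set 'I_n * 'I_n}) (p q x y : 'I_n).

Definition edge_vec (e : 'I_n * 'I_n) : 'rV[R]_n :=
  delta_mx 0 e.1 - delta_mx 0 e.2.

Definition edge_mx : 'M[R]_(#|{: 'I_n * 'I_n}|, n) :=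
  \matrix_i edge_vec (enum_val i).

Definition edge_gram F : R := \det (gram_mx edge_mx (edge_ranks F)).

Lemma mulmx_edge_vec (w : 'rV[R]_n) e :
  (w *m (edge_vec e)^T) 0 0 = w 0 e.1 - w 0 e.2.
Proof.
rewrite /edge_vec linearB /= !trmx_delta mulmxBr -!colE.
by rewrite !mxE.
Qed.

(** The orthogonal projection of the basis vector of x on the space of vectors
    that are constant on each component of F. *)
Definition component_avg F x : 'rV[R]_n :=
  #|component F x|%:R^-1 *: \sum_(y in component F x) delta_mx 0 y.

Lemma component_avgE F x y :
  component_avg F x 0 y = (connect (adjacent F) x y)%:R / #|component F x|%:R.
Proof.
rewrite mxE mulrC; congr (_ / _); rewrite summxE.
rewrite (eq_bigr (fun z => (y == z)%:R)) => [|z _]; last by rewrite mxE.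
have [xy|xy] := boolP (connect _ x y).
  rewrite (bigD1 y) ?inE //= eqxx big1 ?addr0 // => z /andP[_ /negPf].
  by rewrite eq_sym => ->.
rewrite big1 // => z; rewrite inE => xz; case: eqP => // yz.
by rewrite yz xz in xy.
Qed.

Lemma card_component_neq0 F x : #|component F x|%:R != 0 :> R.
Proof. by rewrite pnatr_eq0 -lt0n; apply/card_gt0P; exists x; rewrite inE. Qed.

(** [u_x - avg] is the average of the vectors [u_x - u_y] over the component of
    x, and each of these telescopes along a path from x to y. *)
Lemma delta_sub_component_avg F x m' (W : 'M[R]_(m', n)) :
  (forall f, f \in F -> (edge_vec f <= W)%MS) ->
  (delta_mx 0 x - component_avg F x <= W)%MS.
Proof.
move=> FW.
have connW y z : connect (adjacent F) y z ->
    ((delta_mx 0 y - delta_mx 0 z : 'rV_n) <= W)%MS.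
  case/connectP => s; elim: s y => [|u s IHs] y /=.
    by move=> _ ->; rewrite subrr sub0mx.
  case/andP=> yu /IHs{}IHs /IHs uz.
  rewrite -(subrKA (delta_mx 0 u)) addmx_sub //.
  case/orP: yu => /FW //; rewrite /edge_vec /=.
  by rewrite -eqmx_opp opprB.
rewrite (_ : _ - _ = #|component F x|%:R^-1 *:
   \sum_(y in component F x) (delta_mx 0 x - delta_mx 0 y)).
  by rewrite scalemx_sub // summx_sub // => y; rewrite inE => /connW.
rewrite big_split /= sumr_const sumrN scalerBr -scaler_nat scalerA.
by rewrite mulVf ?scale1r ?card_component_neq0.
Qed.

(** [w = avg_p - avg_q] is the projection of [u_p - u_q] orthogonal to the edge
    vectors of F, and the factor is [w_p - w_q]. *)
Lemma edge_gram_setU1 F p q : (p, q) \notin F ->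
  edge_gram ((p, q) |: F) =
    (if connect (adjacent F) p q then 0
     else #|component F p|%:R^-1 + #|component F q|%:R^-1) * edge_gram F.
Proof.
move=> pqF; pose e := enum_rank (p, q).
pose w := component_avg F p - component_avg F q.
have wE x : w 0 x =
    (connect (adjacent F) p x)%:R / #|component F p|%:R -
    (connect (adjacent F) q x)%:R / #|component F q|%:R.
  by rewrite /w mxE [X in _ + X]mxE !component_avgE.
have row_edge i : row i edge_mx = edge_vec (enum_val i) by rewrite rowK.
rewrite /edge_gram edge_ranks_setU1.
rewrite (@gram_mx_setU1 _ _ _ _ _ _ w).
- congr (_ * _); rewrite row_edge enum_rankK mulmx_edge_vec !wE /= !connect0.
  rewrite [connect _ q p]connect_adjacent_sym; case: ifP => [pq|_].
    move: (pq); rewrite -eq_component => /eqP ->.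
    by rewrite ?pq !subrr.
  by rewrite !mul0r subr0 sub0r opprK !mul1r.
- by rewrite inE enum_rankK.
- rewrite row_edge enum_rankK /edge_vec /w /= opprD addrACA -opprD.
  have FW f : f \in F -> (edge_vec f <=
      \matrix_i (if i \in edge_ranks F then row i edge_mx else 0))%MS.
    move=> fF; apply: (eq_row_sub (enum_rank f)).
    by rewrite rowK inE enum_rankK fF row_edge enum_rankK.
  by rewrite addmx_sub ?eqmx_opp ?delta_sub_component_avg.
- move=> i; rewrite inE row_edge; move: (enum_val i) => f fF.
  apply/rowP => j; rewrite ord1 mulmx_edge_vec [RHS]mxE !wE.
  have f12 : connect (adjacent F) f.1 f.2.
    by apply: connect1; rewrite /adjacent -surjective_pairing fF.
  have sF := connect_adjacent_sym F.
  rewrite ![connect _ _ f.1]sF ![connect _ _ f.2]sF.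
  by rewrite !(same_connect sF f12) subrr.
Qed.

(** Merging P and Q multiplies the product of the sizes by
    [(|P| + |Q|) / (|P| |Q|) = 1/|P| + 1/|Q|], as it does the Gram
    determinant. *)
Lemma edge_gram_forest F : simple_graph F -> acyclic F ->
  edge_gram F = \prod_(B in components F) #|B|%:R.
Proof.
move: F; apply: forest_ind => [|F p q pqF pq IH].
  rewrite big1 => [|B /componentsP[x ->]]; last by rewrite component0 cards1.
  rewrite /edge_gram (_ : gram_mx _ _ = 1%:M) ?det1 //.
  by apply/matrixP => i j; rewrite !mxE !inE.
have Pn0 := card_component_neq0 F p; have Qn0 := card_component_neq0 F q.
rewrite edge_gram_setU1 // (negPf pq) IH.
apply: (mulIf (mulf_neq0 Pn0 Qn0)).
have /= -> := big_components_setU1 pq [the Monoid.com_law (1 : R) of *%R]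
  (fun B => #|B|%:R).
rewrite card_component_setU // natrD; field.
by rewrite Pn0 Qn0.
Qed.

Lemma edge_gram_cyclic F : ~ acyclic F -> edge_gram F = 0.
Proof.
case/cyclic_redundant_edge => -[p q] eF pq; rewrite -(setD1K eF).
by rewrite edge_gram_setU1 ?setD11 // pq mul0r.
Qed.

End EdgeVectors.

(** * The characteristic polynomial *)

Lemma sub_reflection (R : realType) (n : nat) (p q : 'I_n) (u : 'rV[R]_n) :
  u - reflection p q u = (u 0 p - u 0 q) *: edge_vec R (p, q).
Proof.
apply/rowP => j; rewrite /reflection !mxE eqxx /=.
case: tpermP => [->|->|/eqP/negPf -> /eqP/negPf ->].
- rewrite eqxx; case: eqP => [->|_] /=; ring.
- rewrite eqxx; case: eqP => [->|_] /=; ring.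
- by rewrite !subrr mulr0.
Qed.

(** The weight 0 on the pairs that are not increasing lets all pairs index the
    rows of [edge_mx], and removes the edge sets that are not simple graphs. *)
Definition edge_weights (R : realType) (n : nat) (c : 'I_n -> 'I_n -> R)
    : 'rV[R]_#|{: 'I_n * 'I_n}| :=
  \row_i let e : 'I_n * 'I_n := enum_val i in
         if (e.1 < e.2)%N then c e.1 e.2 else 0.

Lemma lin1_reflection_operator (R : realType) (n : nat)
    (c : 'I_n -> 'I_n -> R) :
  lin1_mx (reflection_operator c) =
    (edge_mx R n)^T *m diag_mx (edge_weights c) *m edge_mx R n.
Proof.
apply/row_matrixP => i; rewrite rowE mul_rV_lin1 /= /reflection_operator.
under eq_bigr do rewrite big_mkcond.
rewrite pair_bigA /=.
rewrite (reindex _ (onW_bij _ (@enum_val_bij ('I_n * 'I_n)%type))) /=.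
apply/rowP => j; rewrite mxE mul_mx_diag mxE summxE; apply: eq_bigr => k _.
rewrite !mxE; case: (enum_val k) => p q /=.
case: ifP => _; last by rewrite mulr0 mul0r mxE.
rewrite sub_reflection !mxE !eqxx /= [p == i]eq_sym [q == i]eq_sym; ring.
Qed.

Theorem corollary3 (R : realType) (n : nat) (hn : (1 <= n)%N)
    (c : 'I_n -> 'I_n -> R) :
  char_poly (lin1_mx (reflection_operator c)) =
    \sum_(0 <= k < n.+1) ((-1) ^+ k * mu c k) *: 'X^(n - k).
Proof.
(* The common factor makes up for the different sizes of [V^T D V] and
   [D (V V^T)]. *)
pose m := #|{: 'I_n * 'I_n}|.
have Xm : 'X^m != 0 :> {poly R} by rewrite monic_neq0 ?monicXn.
apply: (mulIf Xm); rewrite lin1_reflection_operator char_poly_weighted_gram.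
rewrite mulr_sumr.
pose term (F : {set 'I_n * 'I_n}) : {poly R} :=
  ((-1) ^+ #|F| * ((\prod_(e in F) c e.1 e.2) *
     (\prod_(B in components F) (#|component_edges F B| + 1)%:R)))
  *: 'X^(n - #|F|).
transitivity (\sum_(F : {set 'I_n * 'I_n} | simple_graph F && `[< acyclic F >])
    term F * 'X^m).
  rewrite (reindex _ (onW_bij _ (edge_ranks_bij n))) /=.
  rewrite [RHS]big_mkcond /=; apply: eq_bigr => F _.
  rewrite card_edge_ranks -/(edge_gram R F).
  have -> : \prod_(i in edge_ranks F) edge_weights c 0 i =
            \prod_(e in F) if (e.1 < e.2)%N then c e.1 e.2 else 0.
    by rewrite -big_edge_ranks; apply: eq_bigr => i _; rewrite mxE.
  case: (boolP (simple_graph F)) => [simpleF|] /=; last first.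
    case/forall_inPn => e eF /negPf e12.
    by rewrite (bigD1 e) //= e12 !mul0r mulr0 scale0r mulr0.
  case: asboolP => [acF|cycF]; last first.
    by rewrite edge_gram_cyclic // !mulr0 scale0r mulr0.
  have [cardF edgesF] := forest_counts simpleF acF.
  have Fm : (#|F| <= m)%N by apply: max_card.
  rewrite edge_gram_forest // /term -scalerAl -scalerAr -!exprD.
  have -> : (n - #|F| + m)%N = (n + (m - #|F|))%N by lia.
  congr (_ * (_ * _) *: _).
    apply: eq_bigr => e eF.
    by move/forall_inP: simpleF => /(_ e eF) ->.
  by apply: eq_bigr => B /edgesF ->.
(* A forest F contributes to the single k equal to its number of edges. *)
rewrite -mulr_suml; under [in RHS]eq_bigr => k _.
  rewrite /mu mulr_sumr scaler_suml (eq_bigr term); last first.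
    by move=> F; rewrite mem_forests => /and3P[_ _ /eqP <-].
  rewrite big_mkcond; over.
rewrite exchange_big /= big_mkcond /=; congr (_ * _); apply: eq_bigr => F _.
rewrite -big_mkcond /=; under eq_bigl do rewrite mem_forests.
case: (boolP (simple_graph F)) => [simpleF|_] /=; last by rewrite big_pred0.
case: asboolP => [acF|_] /=; last by rewrite big_pred0.
have [cardF _] := forest_counts simpleF acF.
under eq_bigl do rewrite eq_sym.
by rewrite big_nat1_eq leq0n ltnS -[leqRHS]cardF leq_addl.
Qed.
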